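(* Every non-reflexive Banach space admits a spreading model that is 1-convex block homogeneous; that is, if $X$ is a non-reflexive Banach space, then there exists a sequence $(x_i)_i$ in $X$ that generates a 1-convex block homogeneous sequence $(e_i)_i$ as a spreading model.
   Context: Banach spaces are real. A bounded sequence $(x_i)_i$ in a Banach space generates a sequence $(e_i)_i$ in a semi-normed space as a spreading model if for any $n\in\mathbb{N}$, $\varepsilon>0$ (and coefficients in a bounded set, say $a_1,\dots,a_n\in[-1,1]$) there is $n_0\in\mathbb{N}$ such that for any $n_0\leqslant k_1<\cdots<k_n$ and all such $a_1,\ldots,a_n$, $$\Big|\Big\|\sum_{i=1}^na_ix_{k_i}\Big\|-\Big\|\sum_{i=1}^na_ie_i\Big\|\Big|<\varepsilon.$$ A Banach space admits $(e_i)_i$ as a spreading model if some sequence in it generates $(e_i)_i$ as a spreading model. A convex block sequence of $(x_i)_i$ is a sequence $(w_k)_k$ with $w_k=\sum_{i\in F_k}c_ix_i$, where $F_1<F_2<\cdots$ are successive finite subsets of $\mathbb{N}$, $c_i\geqslant0$ and $\sum_{i\in F_k}c_i=1$. A Schauder basic sequence is 1-convex block homogeneous if it is isometrically equivalent to each of its convex block sequences. *)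

(* Defs.v *)
(* Real Banach spaces are [completeNormedModType R] with [R : realType]. *)
From HB Require Import structures.
From mathcomp Require Import all_boot all_order all_algebra finmap.
From mathcomp Require Import all_classical all_reals all_analysis.

Set Implicit Arguments.
Unset Strict Implicit.
Unset Printing Implicit Defensive.

Import Order.TTheory GRing.Theory Num.Theory.
Import numFieldNormedType.Exports.

Local Open Scope classical_set_scope.
Local Open Scope ring_scope.

Section dual_space.
Context {R : realType} (X : normedModType R).

Definition dual_pred : {pred X -> R^o} :=
  mem [set f : X -> R^o | linear f /\ continuous f].

Record dual : Type := Dual {
  dual_fun :> X -> R^o ;
  _ : dual_fun \in dual_pred
}.

HB.instance Definition _ := [isSub of dual for dual_fun].
HB.instance Definition _ := [Choice of dual by <:].

Lemma dual_submod_closed : submod_closed dual_pred.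
Proof.
split=> [|a f g /set_mem[lf cf] /set_mem[lg cg]].
  apply/mem_set; split=> [a x y|x]; last exact: cvg_cst.
  by rewrite scaler0 addr0.
apply/mem_set; split=> [b x y|x].
  rewrite fctE -[(a *: f) _]/(a *: f _) lf lg !fctE.
  by rewrite !scalerDr !scalerA (mulrC a b) addrACA.
by apply: cvgD; [apply: cvgZ; [exact: cvg_cst|exact: cf]|exact: cg].
Qed.

HB.instance Definition _ := GRing.isSubmodClosed.Build R (X -> R^o)
  dual_pred dual_submod_closed.
HB.instance Definition _ := [SubChoice_isSubLmodule of dual by <:].

Definition dual_norm (f : dual) : R :=
  sup [set `|f x| | x in [set x : X | `|x| <= 1]].

Lemma dual_linear (f : dual) : linear f.
Proof. by have := valP f; rewrite inE => -[]. Qed.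

Lemma dual_continuous (f : dual) : continuous f.
Proof. by have := valP f; rewrite inE => -[]. Qed.

HB.instance Definition _ (f : dual) :=
  GRing.isLinear.Build R X R^o *:%R f (@dual_linear f).

Lemma dual_has_sup (f : dual) :
  has_sup [set `|f x| | x in [set x : X | `|x| <= 1]].
Proof.
split; first by exists `|f 0|, 0 => //=; rewrite normr0.
have /linear_bounded_continuous/bounded_funP/(_ 1)[M fM] := @dual_continuous f.
by exists M => _ [x x1 <-]; exact: fM.
Qed.

Lemma dual_norm_ub (f : dual) x : `|x| <= 1 -> `|f x| <= dual_norm f.
Proof. by move=> x1; apply: sup_upper_bound; [exact: dual_has_sup|exists x]. Qed.

Lemma dual_norm_le (f : dual) M :
  (forall x, `|x| <= 1 -> `|f x| <= M) -> dual_norm f <= M.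
Proof.
move=> fM; apply: ge_sup; first by case: (dual_has_sup f).
by move=> _ [x x1 <-]; exact: fM.
Qed.

Lemma dual_norm_ge0 (f : dual) : 0 <= dual_norm f.
Proof. by apply: (le_trans (normr_ge0 (f 0))); rewrite dual_norm_ub ?normr0. Qed.

Lemma dual_norm_apply (f : dual) x : `|f x| <= dual_norm f * `|x|.
Proof.
have [->|x0] := eqVneq x 0; first by rewrite linear0 !normr0 mulr0.
have nx0 : 0 < `|x| by rewrite normr_gt0.
rewrite -ler_pdivrMr// mulrC.
have -> : `|x|^-1 * `|f x| = `|f (`|x|^-1 *: x)|.
  by rewrite linearZ normrZ normfV normr_id.
by apply: dual_norm_ub; rewrite normrZ normfV normr_id mulVf// gt_eqF.
Qed.

Lemma dual_norm_triangle (f g : dual) :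
  dual_norm (f + g) <= dual_norm f + dual_norm g.
Proof.
apply: dual_norm_le => x x1.
by rewrite (le_trans (ler_normD _ _))// lerD// dual_norm_ub.
Qed.

Lemma dual_normZ (a : R) (f : dual) : dual_norm (a *: f) = `|a| * dual_norm f.
Proof.
have le b (g : dual) : dual_norm (b *: g) <= `|b| * dual_norm g.
  apply: dual_norm_le => x x1; rewrite [(b *: g) x]/(b *: g x) normrZ.
  by rewrite ler_wpM2l// dual_norm_ub.
apply/eqP; rewrite eq_le le/=.
have [->|a0] := eqVneq a 0; first by rewrite normr0 mul0r dual_norm_ge0.
rewrite mulrC -ler_pdivlMr ?normr_gt0// mulrC -normfV.
by rewrite -[in leLHS](scalerK a0 f) le.
Qed.

Lemma dual_norm0_eq0 (f : dual) : dual_norm f = 0 -> f = 0.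
Proof.
move=> f0; apply/val_inj/funext => x; apply/eqP.
by rewrite -normr_le0; have := dual_norm_apply f x; rewrite f0 mul0r.
Qed.

HB.instance Definition _ :=
  Lmodule_isNormed.Build R dual dual_norm_triangle dual_normZ dual_norm0_eq0.

End dual_space.
Arguments dual_pred {R} X.

Section reflexivity.
Context {R : realType} (X : normedModType R).

Definition eval_at (x : X) : dual X -> R^o := fun f => f x.

Lemma eval_at_dual x : eval_at x \in dual_pred (dual X).
Proof.
have lx : linear (eval_at x) by [].
pose g : {linear dual X -> R^o} :=
  HB.pack (eval_at x) (GRing.isLinear.Build _ _ _ _ _ lx).
rewrite inE; split=> //.
apply: (@bounded_linear_continuous _ _ _ g); apply/bounded_funP => r.
exists (r * `|x|) => f fr; apply: le_trans (dual_norm_apply f x) _.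
by rewrite ler_wpM2r.
Qed.

Definition canonical_embedding (x : X) : dual (dual X) := Dual (eval_at_dual x).

Definition reflexive_space : Prop :=
  range canonical_embedding = [set: dual (dual X)].

End reflexivity.

Section sequences_in_modules.
Context {R : realType}.

Record seminorm (E : lmodType R) : Type := Seminorm {
  seminorm_fun :> E -> R ;
  seminorm_triangle :
    forall u v, seminorm_fun (u + v) <= seminorm_fun u + seminorm_fun v ;
  seminorm_scale : forall a u, seminorm_fun (a *: u) = `|a| * seminorm_fun u
}.

Definition norm_seminorm (E : normedModType R) : seminorm E :=
  @Seminorm E Num.norm (@ler_normD R E) (@normrZ R E).

Definition generates_spreading_model (X : normedModType R) (x : nat -> X)
    (E : lmodType R) (p : seminorm E) (e : nat -> E) : Prop :=
  (exists M : R, forall i, `|x i| <= M) /\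
  forall (n : nat) (eps : R), 0 < eps ->
  exists n0 : nat, forall k : 'I_n -> nat,
    (forall i, (n0 <= k i)%N) ->
    (forall i j : 'I_n, (i < j)%N -> (k i < k j)%N) ->
    forall a : 'I_n -> R, (forall i, -1 <= a i <= 1) ->
    `| `|\sum_(i < n) a i *: x (k i)| - p (\sum_(i < n) a i *: e i) | < eps.

(* The blocks are non-empty because the coefficients of each sum to 1; they are
   disjoint, so a single family [c] provides the coefficients of all of them. *)
Definition convex_block_sequence (E : lmodType R) (x w : nat -> E) : Prop :=
  exists (F : nat -> {fset nat}) (c : nat -> R),
    [/\ forall k l, (k < l)%N ->
          forall i j, i \in F k -> j \in F l -> (i < j)%N,
        forall i, 0 <= c i,
        forall k, \sum_(i <- F k) c i = 1 &
        forall k, w k = \sum_(i <- F k) c i *: x i].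

Definition isometrically_equivalent (E E' : normedModType R)
    (x : nat -> E) (y : nat -> E') : Prop :=
  forall (n : nat) (a : 'I_n -> R),
    `|\sum_(i < n) a i *: x i| = `|\sum_(i < n) a i *: y i|.

Definition seq_span (E : lmodType R) (e : nat -> E) : set E :=
  [set v | exists (n : nat) (a : 'I_n -> R), v = \sum_(i < n) a i *: e i].

(* [e] is a Schauder basis of its closed linear span; linear independence
   comes from the uniqueness of the expansion. *)
Definition schauder_basic_sequence (E : completeNormedModType R)
    (e : nat -> E) : Prop :=
  forall v, closure (seq_span e) v ->
    exists! a : nat -> R, series (fun i => a i *: e i) @ \oo --> v.

Definition convex_block_homogeneous1 (E : completeNormedModType R)
    (e : nat -> E) : Prop :=
  schauder_basic_sequence e /\
  forall w : nat -> E,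
    convex_block_sequence e w -> isometrically_equivalent e w.

End sequences_in_modules.

(* Main.v *)
Require Import Defs.
From HB Require Import structures.
From mathcomp Require Import all_boot all_order all_algebra finmap.
From mathcomp Require Import all_classical all_reals all_analysis.
From mathcomp Require Import ring lra zify.

Set Implicit Arguments.
Unset Strict Implicit.
Unset Printing Implicit Defensive.

Import Order.TTheory GRing.Theory Num.Theory.
Import numFieldNormedType.Exports.

Local Open Scope classical_set_scope.
Local Open Scope ring_scope.

(* Take [z] in the bidual at distance [d > 0] from [X]. By Goldstine, the
   weak-star neighbourhoods of [z] trace nonempty convex sets on the ball of
   radius [|z|] of [X]; let [F] be a maximal filter among those generated by
   convex sets that refines these traces. By maximality every bounded convex
   function [f] converges along [F]: with [s] its limit inferior, the convex
   sublevel set [f <= s + eps] meets every member of [F], so it belongs to [F].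
   The iterated limits [lim_{v_1} ... lim_{v_n} |sum a_i v_i|] along [F] thus
   exist and define a norm on finitely supported sequences. Each limit may be
   computed on a convex member of [F], which is stable under convex
   combinations, so this norm is 1-convex block homogeneous. Since [v] tends
   weak-star to [z], the limit of [|x + sum a_i v_i|] is at least
   [|x + (sum a_i) z|], which gives a basis constant [1 + |z| / d]. A sequence
   generating this norm as a spreading model is picked greedily, the
   convergence being uniform over bounded coefficients by compactness. *)

(** * The Hahn-Banach theorem and duality *)

Section hahn_banach.
Context {R : realType} {V : lmodType R}.
Implicit Types (p q : V -> R) (x y : V).

(** Homogeneity is asked as one inequality for positive [t], which is easy to check for infima;
    applying it with the inverse of [t] gives equality. *)
Definition sublinear p :=
  (forall x y, p (x + y) <= p x + p y) /\
  (forall (t : R) x, 0 < t -> p (t *: x) <= t * p x).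

Lemma sublinear0 p : sublinear p -> p 0 = 0.
Proof.
move=> [_ pZ].
have := pZ 2 0 (ltr0n _ 2); have /(pZ _ 0) : (0 : R) < 2^-1 by rewrite invr_gt0.
by rewrite !scaler0 => h1 h2; lra.
Qed.

Lemma sublinearZ p t x : sublinear p -> 0 <= t -> p (t *: x) = t * p x.
Proof.
move=> sp; rewrite le_eqVlt => /predU1P[<-|t0].
  by rewrite scale0r mul0r sublinear0.
case: sp => _ pZ; apply/eqP; rewrite eq_le pZ//= mulrC -ler_pdivlMr// mulrC.
have /(pZ _ (t *: x)) : 0 < t^-1 by rewrite invr_gt0.
by rewrite scalerA mulVf ?gt_eqF// scale1r.
Qed.

Lemma sublinear_oppr_ge p x : sublinear p -> - p (- x) <= p x.
Proof.
by move=> sp; have := sp.1 x (- x); rewrite subrr sublinear0// -lerBlDr sub0r.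
Qed.

(* The largest sublinear functional below [p] with value at most [- p y] at
   [- y]; a minimal sublinear [p] therefore equals all its [shave p y], which
   makes it odd and hence linear. *)
Definition shave p y x : R :=
  inf [set p (x + t *: y) - t * p y | t in [set t : R | 0 <= t]].

Lemma shave_has_inf p y x : sublinear p ->
  has_inf [set p (x + t *: y) - t * p y | t in [set t : R | 0 <= t]].
Proof.
move=> sp; split; first by exists (p (x + 0 *: y) - 0 * p y); exists 0 => /=.
exists (- p (- x)) => _ /= [t t0 <-].
have := sp.1 (x + t *: y) (- x).
by rewrite addrAC subrr add0r (sublinearZ _ sp)// => ?; lra.
Qed.

Lemma shave_le p y x t : sublinear p -> 0 <= t ->
  shave p y x <= p (x + t *: y) - t * p y.
Proof.
move=> sp t0; apply: ge_inf; last by exists t.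
by have [] := shave_has_inf y x sp.
Qed.

Lemma shave_ge p y x M : sublinear p ->
  (forall t, 0 <= t -> M <= p (x + t *: y) - t * p y) -> M <= shave p y x.
Proof.
move=> sp h; apply: lb_le_inf; first by have [] := shave_has_inf y x sp.
by move=> _ [t t0 <-]; exact: h.
Qed.

(** Parameters [s] for [x] and [t] for [x'] add up to a parameter for [x + x']; for homogeneity the
    parameter is scaled along with the vector. *)
Lemma shave_sublinear p y : sublinear p -> sublinear (shave p y).
Proof.
move=> sp; split=> [x x'|t x t0].
  rewrite -lerBlDl; apply: shave_ge => // t t0.
  rewrite lerBlDr -lerBlDl; apply: shave_ge => // s s0.
  rewrite lerBlDr.
  apply: (le_trans (@shave_le p y (x + x') (s + t) sp _)); first exact: addr_ge0.
  have := sp.1 (x + s *: y) (x' + t *: y).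
  by rewrite scalerDl addrACA => h; lra.
rewrite mulrC -ler_pdivrMr//; apply: shave_ge => // s s0.
rewrite ler_pdivrMr//.
apply: (le_trans (@shave_le p y (t *: x) (t * s) sp _)).
  by rewrite mulr_ge0// ltW.
by rewrite -scalerA -scalerDr (sublinearZ _ sp (ltW t0)); lra.
Qed.

Lemma shave_le_id p y x : sublinear p -> shave p y x <= p x.
Proof.
move=> sp; have := @shave_le p y x 0 sp (lexx _).
by rewrite scale0r addr0 mul0r subr0.
Qed.

Lemma shave_oppr p y : sublinear p -> shave p y (- y) <= - p y.
Proof.
move=> sp; have := @shave_le p y (- y) 1 sp ler01.
by rewrite scale1r addNr (sublinear0 sp) sub0r mul1r.
Qed.

Lemma minimal_sublinear_linear p : sublinear p ->
  (forall q, sublinear q -> (forall x, q x <= p x) -> forall x, p x <= q x) ->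
  linear (p : V -> R^o).
Proof.
move=> sp pmin.
have pD x y : p (x + y) = p x + p y.
  apply/eqP; rewrite eq_le sp.1/=.
  (* Minimality gives [p x <= shave p y x]; the parameter [1] in the infimum then yields
     superadditivity. *)
  have := pmin _ (shave_sublinear y sp) (fun x => shave_le_id y x sp) x.
  move=> /le_trans/(_ (@shave_le p y x 1 sp ler01)).
  by rewrite scale1r mul1r lerBrDr.
have pN x : p (- x) = - p x.
  by apply/eqP; rewrite -addr_eq0 -pD addNr (sublinear0 sp).
have pZ t x : p (t *: x) = t * p x.
  have [t0|t0] := leP 0 t; first exact: sublinearZ.
  rewrite -[t]opprK scaleNr pN (sublinearZ _ sp) ?mulNr// oppr_ge0 ltW//.
by move=> t x y; rewrite pD pZ.
Qed.

(** Zorn's lemma for the reversed pointwise order. A chain is bounded by its pointwise infimum,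
    finite since members are at least [- p0 (- x)] at [x]; the infimum is subadditive because the
    smaller of two members serves both arguments. *)
Lemma exists_minimal_sublinear p0 : sublinear p0 ->
  exists p, [/\ sublinear p, (forall x, p x <= p0 x) &
    forall q, sublinear q -> (forall x, q x <= p x) -> forall x, p x <= q x].
Proof.
move=> sp0.
pose T := {p | sublinear p /\ forall x, p x <= p0 x}.
pose Rel (p q : T) := `[< forall x, sval q x <= sval p x >].
have [||A Atot|[p [sp pp0]] pmax] :=
    @ZL_preorder T (exist _ p0 (conj sp0 (fun=> lexx _))) Rel.
- by move=> p; apply/asboolP.
- move=> p q r /asboolP pq /asboolP qr; apply/asboolP => x.
  exact: le_trans (qr x) (pq x).
- have [[a Aa]|A0] := pselect (A !=set0); last first.
    exists (exist _ p0 (conj sp0 (fun=> lexx _))) => s As.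
    by exfalso; apply: A0; exists s.
  pose S x := [set sval p x | p in A].
  have Sinf x : has_inf (S x).
    split; first by exists (sval a x), a.
    exists (- p0 (- x)) => _ [[p [sp pp0]] Ap <-] /=.
    by apply: le_trans (sublinear_oppr_ge _ sp); rewrite lerN2.
  have Sle (p : T) x : A p -> inf (S x) <= sval p x.
    by move=> Ap; apply: ge_inf; [case: (Sinf x)|exists p].
  have Sge M x : (forall p : T, A p -> M <= sval p x) -> M <= inf (S x).
    move=> h; apply: lb_le_inf; first by case: (Sinf x).
    by move=> _ [p Ap <-]; exact: h.
  have si : sublinear (fun x => inf (S x)).
    split=> [x y|t x t0].
      rewrite -lerBlDl; apply: (Sge _ _) => p Ap; rewrite lerBlDr -lerBlDl.
      apply: (Sge _ _) => q Aq; rewrite lerBlDr.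
      have [/asboolP pq|/asboolP qp] := Atot _ _ Ap Aq.
        apply: (le_trans (Sle _ _ Aq)); apply: (le_trans ((svalP q).1.1 _ _)).
        by rewrite lerD2l pq.
      apply: (le_trans (Sle _ _ Ap)); apply: (le_trans ((svalP p).1.1 _ _)).
      by rewrite lerD2r qp.
    rewrite mulrC -ler_pdivrMr//; apply: (Sge _ _) => p Ap; rewrite ler_pdivrMr// mulrC.
    by apply: (le_trans (Sle _ _ Ap)); apply: (svalP p).1.2.
  have Sp0 x : inf (S x) <= p0 x := le_trans (Sle a x Aa) ((svalP a).2 x).
  exists (exist _ (fun x => inf (S x)) (conj si Sp0)).
  by move=> s As; apply/asboolP => x /=; exact: Sle.
exists p; split=> // q sq qp x.
have qp0 y : q y <= p0 y by exact: le_trans (qp y) (pp0 y).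
have /asboolP := pmax (exist _ q (conj sq qp0)) ltac:(exact/asboolP).
exact.
Qed.

End hahn_banach.

Section norming.
Context {R : realType} (V : normedModType R).

Lemma norm_sublinear : sublinear (fun x : V => `|x|).
Proof.
split=> [x y|t x t0]; first exact: ler_normD.
by rewrite normrZ gtr0_norm.
Qed.

Lemma linear_bounded_in_dual (f : V -> R^o) (M : R) : linear f ->
  (forall x, `|f x| <= M * `|x|) -> f \in dual_pred V.
Proof.
move=> lf fM.
pose g : {linear V -> R^o} := HB.pack f (GRing.isLinear.Build _ _ _ _ _ lf).
rewrite inE; split=> //.
apply: (@bounded_linear_continuous _ _ _ g); apply/bounded_funP => r.
exists (`|M| * r) => x xr; apply: le_trans (fM x) _.
by apply: (le_trans (ler_wpM2r _ (ler_norm M))) => //; rewrite ler_wpM2l.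
Qed.

(** A minimal sublinear functional below the norm shaved along [x] is linear and at most [- |x|] at
    [- x], hence equal to [|x|] at [x]. *)
Lemma norming_functional (x : V) :
  exists f : dual V, `|f| <= 1 /\ f x = `|x|.
Proof.
have sn := norm_sublinear.
have [p [sp pn pmin]] := exists_minimal_sublinear (shave_sublinear x sn).
have lp := minimal_sublinear_linear sp pmin.
have pnorm y : p y <= `|y| by apply: le_trans (pn y) (shave_le_id x y sn).
have pN y : p (- y) = - p y.
  have := lp (-1) y 0; rewrite addr0 scaleN1r (sublinear0 sp) addr0 => ->.
  exact: mulN1r.
have pabs y : `|p y| <= `|y|.
  by rewrite ler_norml pnorm andbT lerNl -pN (le_trans (pnorm _))// normrN.
have pd : (p : V -> R^o) \in dual_pred V.
  by apply: (@linear_bounded_in_dual _ 1) => // y; rewrite mul1r.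
exists (Dual pd); split.
  by apply: dual_norm_le => y y1; exact: le_trans (pabs y) y1.
apply/eqP; rewrite eq_le pnorm/= -lerN2 -pN.
by rewrite (le_trans (pn _))// (shave_oppr x sn).
Qed.

Lemma canonical_embedding_norm (x : V) : `|canonical_embedding x| = `|x|.
Proof.
apply/eqP; rewrite eq_le; apply/andP; split.
  apply: dual_norm_le => f f1; apply: le_trans (dual_norm_apply f x) _.
  by rewrite ler_piMl.
have [f [f1 fx]] := norming_functional x.
rewrite -[leLHS]ger0_norm// -[X in `|X|]fx.
exact: (@dual_norm_ub _ _ (canonical_embedding x) f).
Qed.

Lemma canonical_embedding_linear : linear (@canonical_embedding R V).
Proof. by move=> a x y; apply/val_inj/funext => f /=; rewrite [LHS]linearP. Qed.

HB.instance Definition _ := GRing.isLinear.Build R V (dual (dual V)) *:%R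
  (@canonical_embedding R V) canonical_embedding_linear.

End norming.

(** * Completeness of the dual *)

Section dual_complete.
Context {R : realType} (V : normedModType R).

Lemma dual_cauchy_cvg (F : set_system (dual V)) :
  ProperFilter F -> cauchy F -> cvg F.
Proof.
move=> FF /cauchyP Fc.
have ev (f g : dual V) e (x : V) : ball f e g -> `|f x - g x| <= e * `|x|.
  rewrite -ball_normE /= => fg.
  apply: le_trans (dual_norm_apply (f - g) x) _.
  by rewrite ler_wpM2r// ltW.
have cvx (x : V) : cvg ((fun f : dual V => f x : R^o) @ F).
  apply: cauchy_cvg; apply: cauchy_exP => e e0.
  have /Fc[f Ff] : 0 < e / (`|x| + 1) by rewrite divr_gt0// ltr_wpDl.
  exists (f x : R^o); move: Ff; apply: (@filterS _ F) => g fg; have h := @ev _ _ _ x fg.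
  rewrite -ball_normE /=; apply: le_lt_trans h _.
  by rewrite mulrAC ltr_pdivrMr ?ltr_wpDl// ltr_pM2l// ltrDl.
pose g (x : V) : R^o := lim ((fun f : dual V => f x : R^o) @ F).
have lg : linear g.
  move=> a x y; apply/cvg_lim => //.
  under [X in X @ _]eq_fun do rewrite linearP.
  by apply: cvgD (cvx y); apply: cvgZr; exact: cvx.
(* The Cauchy estimate passes to the pointwise limit with the same constant, uniformly on the unit
   ball. *)
have gf e (f : dual V) (x : V) : F (ball f e) -> `|g x - f x| <= e * `|x|.
  move=> Ff; apply: (cvgr_to_le (F := F) (f := fun h : dual V => `|h x - f x|)).
    by apply: cvg_norm; apply: cvgB; [exact: cvx|exact: cvg_cst].
  by move: Ff; apply: (@filterS _ F) => h /(@ev _ _ _ x); rewrite distrC.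
have gd : g \in dual_pred V.
  have [f0 Ff0] := Fc 1 ltr01.
  apply: (@linear_bounded_in_dual _ _ _ (1 + `|f0|)) => // x.
  rewrite -[g x](subrK (f0 x)) mulrDl (le_trans (ler_normD _ _))// lerD//.
    exact: gf.
  exact: dual_norm_apply.
apply: (@cvgP _ _ (Dual gd)); apply/cvgrPdist_le => e e0.
have /Fc[f Ff] : 0 < e / 2 by rewrite divr_gt0.
near=> h.
have fh : ball f (e / 2) h by near: h.
apply: dual_norm_le => x x1.
rewrite -[leLHS]/(`|g x - h x|) -[g x - h x](subrKA (f x)).
rewrite (splitr e) (le_trans (ler_normD _ _))// lerD//.
  by rewrite (le_trans (@gf _ _ _ Ff))// ler_piMr// ltW// divr_gt0.
by rewrite (le_trans (@ev _ _ _ _ fh))// ler_piMr// ltW// divr_gt0.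
Unshelve. all: by end_near. Qed.

HB.instance Definition _ := Uniform_isComplete.Build (dual V) dual_cauchy_cvg.

End dual_complete.

Lemma completion_exists {R : realType} (V : normedModType R) :
  exists (E : completeNormedModType R) (i : {linear V -> E}),
    forall v, `|i v| = `|v|.
Proof.
exists (dual (dual V)), (@canonical_embedding R V) => v.
exact: canonical_embedding_norm.
Qed.

(** * Goldstine's theorem and the distance to the space *)

Section bidual.
Context {R : realType} (V : normedModType R).

Lemma bidual_sum (z : dual (dual V)) (s : seq (dual V)) (r : dual V -> R) :
  z (\sum_(f <- s) r f *: f) = \sum_(f <- s) r f * z f.
Proof. by rewrite linear_sum; apply: eq_bigr => f _; rewrite linearZ. Qed.

(* A near minimiser [x0] of [sum (f x - z f)^2] on the ball almost minimises
   [g = sum (f x0 - z f) f] there, whence [g x0 <= - |z| |g| + small], while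
   [g x0 - z g] is the sum itself. *)
Lemma goldstine (z : dual (dual V)) (s : seq (dual V)) (e : R) : 0 < e ->
  exists x : V, `|x| <= `|z| /\ forall f, f \in s -> `|f x - z f| <= e.
Proof.
move=> e0.
pose phi (x : V) : R := \sum_(f <- s) (f x - z f) ^+ 2.
pose S := [set phi x | x in [set x : V | `|x| <= `|z|]].
have Sinf : has_inf S.
  split; first by exists (phi 0), 0 => //=; rewrite normr0.
  by exists 0 => _ [x _ <-]; apply: sumr_ge0 => f _; exact: sqr_ge0.
have infS x : `|x| <= `|z| -> inf S <= phi x.
  by move=> xz; apply: ge_inf; [case: Sinf|exists x].
suff S0 : inf S <= 0.
  have [_ [x xz <-] xe] := inf_adherent (exprn_gt0 2 e0) Sinf.
  exists x; split=> // f fs.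
  rewrite -(@ler_pXn2r _ 2) ?nnegrE//; last exact: ltW.
  rewrite real_normK ?num_real//.
  apply: (@le_trans _ _ (phi x)).
    rewrite /phi (big_rem f)//= lerDl.
    by apply: sumr_ge0 => g _; exact: sqr_ge0.
  by apply: ltW; apply: (lt_le_trans xe); rewrite gerDr.
rewrite leNgt; apply/negP => del0; set del := inf S in del0.
(* Bounds the sum of the squares [(f w) ^+ 2] for differences [w] of two points of the ball. *)
pose C : R := \sum_(f <- s) (`|f| * (`|z| + `|z|)) ^+ 2.
have C0 : 0 <= C by apply: sumr_ge0 => f _; exact: sqr_ge0.
(* A move of size [lam] towards a point of the ball leaves, after division by [lam], the errors
   [lam] from near-minimality and [lam * C] from the quadratic term; half their sum must stay below
   [del]. *)
have [lam [lam0 lam1 lamC]] :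
    exists lam : R, [/\ 0 < lam, lam <= 1 & lam * (1 + C) <= del].
  have C1 : 0 < 1 + C by exact: ltr_pwDl.
  exists (Num.min 1 (del / (1 + C))); split.
  - by rewrite lt_min ltr01/= divr_gt0.
  - by rewrite ge_min lexx.
  - by rewrite -ler_pdivlMr// ge_min lexx orbT.
have [_ [x0 x0z <-] x0l] := inf_adherent (exprn_gt0 2 lam0) Sinf.
rewrite -/del in x0l.
pose r (f : dual V) := f x0 - z f.
pose g : dual V := \sum_(f <- s) r f *: f.
have gE x : g x = \sum_(f <- s) r f * f x.
  exact: (bidual_sum (canonical_embedding x)).
pose B := - g x0 + lam * (1 + C) / 2.
have gB y : `|y| <= `|z| -> - g y <= B.
  move=> yz; pose w := y - x0.
  have xl : `|x0 + lam *: w| <= `|z|.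
    have -> : x0 + lam *: w = (1 - lam) *: x0 + lam *: y.
      by rewrite /w scalerBr scalerBl scale1r addrA addrAC.
    rewrite (le_trans (ler_normD _ _))// !normrZ !ger0_norm ?subr_ge0//; last exact: ltW.
    rewrite (_ : `|z| = (1 - lam) * `|z| + lam * `|z|); last by rewrite -mulrDl subrK mul1r.
    by rewrite lerD// ler_wpM2l// ?subr_ge0// ltW.
  have phiE : phi (x0 + lam *: w) =
      phi x0 + 2 * lam * g w + lam ^+ 2 * \sum_(f <- s) (f w) ^+ 2.
    rewrite gE /phi !mulr_sumr -!big_split /=; apply: eq_bigr => f _.
    by rewrite linearD linearZ /r /= -[lam *: f w]/(lam * f w); ring.
  have wC : \sum_(f <- s) (f w) ^+ 2 <= C.
    apply: ler_sum => f _; rewrite -(real_normK (num_real (f w))).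
    rewrite ler_pXn2r ?nnegrE ?mulr_ge0 ?addr_ge0//.
    apply: (le_trans (dual_norm_apply f w)); rewrite ler_wpM2l ?dual_norm_ge0//.
    by rewrite /w (le_trans (ler_normB _ _))// lerD.
  have := infS _ xl; rewrite phiE -/del => h.
  have hC : lam ^+ 2 * \sum_(f <- s) (f w) ^+ 2 <= lam ^+ 2 * C.
    by rewrite ler_wpM2l// sqr_ge0.
  have : 0 <= lam * (lam + 2 * g w + lam * C) by nra.
  rewrite pmulr_rge0// /w linearB /B => hw.
  rewrite -subr_ge0; lra.
have gB' y : `|y| <= `|z| -> `|g y| <= B.
  move=> yz; rewrite ler_norml lerNl gB//=.
  by have := gB (- y); rewrite normrN linearN opprK; exact.
have gzB : `|g| * `|z| <= B.
  have [z0|z0] := eqVneq `|z| 0.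
    rewrite z0 mulr0; have := gB' 0; rewrite normr0 linear0 normr0.
    by apply.
  have {}z0 : 0 < `|z| by rewrite lt_neqAle eq_sym z0/=.
  rewrite -ler_pdivlMr//; apply: dual_norm_le => x x1.
  rewrite ler_pdivlMr// mulrC -[X in X * _](ger0_norm (normr_ge0 z)).
  have -> : `| `|z| | * `|g x| = `|g (`|z| *: x)| by rewrite linearZ normrZ.
  by apply: gB'; rewrite normrZ normr_id ler_piMr.
have zg : - (`|g| * `|z|) <= z g.
  by have := dual_norm_apply z g; rewrite ler_norml mulrC => /andP[].
have phix0 : g x0 - z g = phi x0.
  rewrite gE bidual_sum -sumrB; apply: eq_bigr => f _.
  by rewrite /r; ring.
(* The difference [g x0 - z g] is at least [del], but by [gzB] and [zg] at most
   [lam * (1 + C) / 2 <= del / 2]. *)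
have := infS _ x0z; rewrite -/del -phix0 /B in gzB *.
by move=> h; lra.
Qed.

End bidual.

(** A complete space is closed in its bidual: at distance zero, the points of [X] approximating
    [- z] would form a Cauchy filter, whose limit represents [- z]. *)
Lemma bidual_dist_gt0 {R : realType} (X : completeNormedModType R)
    (z : dual (dual X)) : ~ range (@canonical_embedding R X) z ->
  exists d : R, 0 < d /\ forall x, d <= `|canonical_embedding x + z|.
Proof.
move=> zX; apply: contrapT => nd; apply: zX.
pose A (e : R) := [set x : X | `|canonical_embedding x + z| < e].
have A0 e : 0 < e -> A e !=set0.
  move=> e0; apply: contrapT => Ae; apply: nd; exists e; split=> // x.
  by rewrite leNgt; apply/negP => xe; apply: Ae; exists x.
pose F : set_system X := filter_from [set e : R | 0 < e] A.
have FF : ProperFilter F.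
  apply: filter_from_proper => //; apply: filter_from_filter.
    by exists 1; exact: ltr01.
  move=> e e' /= e0 e'0; exists (Num.min e e'); first by rewrite /= lt_min e0.
  by move=> x; rewrite /A /= lt_min => /andP[].
have JB x y : `|x - y| = `|(canonical_embedding x + z) - (canonical_embedding y + z)|.
  rewrite -canonical_embedding_norm opprD addrACA subrr addr0.
  by rewrite linearB.
have AB e x y : A (e / 2) x -> A (e / 2) y -> `|x - y| < e.
  rewrite /A /= => xe ye; rewrite JB; apply: le_lt_trans (ler_normB _ _) _.
  by rewrite [e in _ < e](splitr e); exact: ltrD xe ye.
have /cvg_ex[/= x Fx] : cvg F.
  apply: cauchy_cvg; apply: cauchy_exP => e e0.
  have [y ye] := A0 _ (divr_gt0 e0 (ltr0n _ 2)).
  exists y; exists (e / 2); first exact: divr_gt0.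
  by move=> x xe; rewrite -ball_normE; exact: (AB _ _ _ ye xe).
exists (- x) => //.
rewrite linearN; apply/eqP; rewrite eq_sym -subr_eq0 opprK addrC -normr_le0.
apply/ler_addgt0Pr => e e0.
rewrite add0r.
have e2 : 0 < e / 2 by exact: divr_gt0.
have Fe : F (A (e / 2)) by exists (e / 2).
move/fcvgrPdist_lt: Fx => /(_ _ e2) Fx.
have [y [ye xy]] := filter_ex (filterI Fe Fx).
rewrite -(subrK (canonical_embedding y + z) (_ + z)) (le_trans (ler_normD _ _))//.
by rewrite -JB [e in _ <= e]splitr lerD// ltW.
Qed.

(** * Maximal convex filters *)

Section convex_filters.
Context {R : realType} {V : lmodType R}.
Implicit Types (A C D : set V) (B : set (set V)).

Definition is_convex C := forall x y (t : R),
  C x -> C y -> 0 <= t <= 1 -> C (t *: x + (1 - t) *: y).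

Definition convex_function (f : V -> R) := forall x y (t : R),
  0 <= t <= 1 -> f (t *: x + (1 - t) *: y) <= t * f x + (1 - t) * f y.

Definition convex_base B :=
  [/\ B !=set0, (forall C, B C -> is_convex C /\ C !=set0) &
      forall C D, B C -> B D -> B (C `&` D)].

(** An ultrafilter contains every set meeting all its members; here this is asked of convex sets
    only, and convex members form a base. *)
Definition maximal_convex_filter (F : set_system V) :=
  [/\ ProperFilter F,
      (forall A, F A -> exists C, [/\ F C, is_convex C & C `<=` A]) &
      forall D, is_convex D -> (forall A, F A -> A `&` D !=set0) -> F D].

Lemma is_convexI C D : is_convex C -> is_convex D -> is_convex (C `&` D).
Proof. by move=> cC cD x y t [? ?] [? ?] t01; split; [exact: cC|exact: cD]. Qed.

Lemma sublevel_convex (f : V -> R) r :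
  convex_function f -> is_convex [set x | f x <= r].
Proof.
move=> cf x y t /= fx fy t01; apply: le_trans (cf _ _ _ t01) _.
by have /andP[t0 t1] := t01; nra.
Qed.

Lemma maximal_convex_filter_exists B0 : convex_base B0 ->
  exists F, maximal_convex_filter F /\ forall C, B0 C -> F C.
Proof.
move=> [[C0 BC0] B0c B0I].
pose P B := B = set0 \/ (B0 `<=` B /\ convex_base B).
have [G GP Gtot|B [[B_0|[B0B [Bn Bc BI]]] Bmax]] := @Zorn_bigcup _ P.
- have [[B GB [B0B Bb]]|none] :=
    pselect (exists2 B, G B & B0 `<=` B /\ convex_base B); last first.
    left; apply/seteqP; split=> // C [B GB BC].
    by case: (GP _ GB) => [B_0|Bb]; [rewrite B_0 in BC|case: none; exists B].
  right; split; first by move=> C B0C; exists B => //; exact: B0B.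
  split; first by exists C0, B => //; exact: B0B.
    move=> C [B' GB' B'C]; have [B'0|[_ [_ B'c _]]] := GP _ GB'.
      by rewrite B'0 in B'C.
    exact: B'c.
  move=> C D [B1 G1 BC1] [B2 G2 BD2].
  have [B3 [G3 B3C B3D]] : exists B3, [/\ G B3, B3 C & B3 D].
    have [B12|B21] := Gtot _ _ G1 G2; first by exists B2; split=> //; exact: B12.
    by exists B1; split=> //; exact: B21.
  exists B3 => //; have [B30|[_ [_ _ B3I]]] := GP _ G3; last exact: B3I.
  by rewrite B30 in B3C.
- exfalso; apply: (Bmax B0); last by right; split=> //; split=> //; exists C0.
  by rewrite B_0; split; [move=> ? []|move=> /(_ _ BC0)].
have FF : ProperFilter (filter_from B id).
  apply: filter_from_proper; last by move=> C /Bc[].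
  apply: filter_from_filter => // C D BC BD.
  by exists (C `&` D) => //; exact: BI.
exists (filter_from B id); split; last by move=> C B0C; exists C => //; exact: B0B.
split=> // [A [C BC CA]|D cD Dmeet].
  by exists C; split=> //; [exists C|case: (Bc _ BC)].
(* If [D] contained no member of [B], adjoining the traces on [D] would give a strictly larger
   convex base. *)
pose B' := B `|` [set C `&` D | C in B].
have [//|CD] := pselect (exists2 C, B C & C `<=` D).
exfalso; apply: (Bmax B').
  split=> [C BC|B'B]; first by left.
  have [C BC] := Bn; apply: CD; exists (C `&` D) => //.
  by apply: B'B; right; exists C.
right; split=> [C B0C|]; first by left; exact: B0B.
split; first by have [C BC] := Bn; exists C; left.
  move=> E [/Bc//|[C BC <-]]; split; first by apply: is_convexI => //; case: (Bc _ BC).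
  by apply: Dmeet; exists C.
move=> E E' [BC|[C BC <-]] [BC'|[C' BC' <-]].
- by left; exact: BI.
- by right; eexists; [exact: (BI _ _ BC BC')|rewrite setIA].
- by right; eexists; [exact: (BI _ _ BC BC')|rewrite setIAC].
- by right; eexists; [exact: (BI _ _ BC BC')|rewrite setIACA setIid].
Qed.

Lemma convex_function_cvg (F : set_system V) (f : V -> R) (m M : R) :
  maximal_convex_filter F -> convex_function f ->
  (\forall x \near F, m <= f x) -> (\forall x \near F, f x <= M) ->
  cvg (f @ F).
Proof.
move=> [FF _ Fmax] cf fm fM.
pose S := [set r : R | \forall x \near F, r <= f x].
have Sub : has_sup S.
  split; first by exists m.
  exists M => r Sr; have [x [rx xM]] := filter_ex (filterI Sr fM).
  exact: le_trans rx xM.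
apply: (@cvgP _ _ (sup S)); apply/cvgrPdist_le => e e0.
have [r Sr rS] := sup_adherent e0 Sub.
have Fe : F [set x | f x <= sup S + e].
  apply: Fmax; first exact: sublevel_convex.
  move=> A FA; apply: contrapT => ne.
  have : S (sup S + e).
    apply: filterS FA => x Ax; rewrite leNgt; apply/negP => /ltW xe.
    by apply: ne; exists x.
  by move=> /(sup_upper_bound Sub); rewrite gerDl leNgt e0.
apply: filterS2 Fe Sr => x /= xe rx.
by rewrite ler_distlC xe andbT (le_trans _ rx)// ltW.
Qed.

End convex_filters.

(** Goldstine's theorem makes the base sets [C s] nonempty, and concatenating lists intersects them.
    The fixed tolerance [1] suffices because functionals may be rescaled by [e^-1]. *)
Lemma bidual_convex_filter {R : realType} (V : normedModType R)
    (z : dual (dual V)) :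
  exists F : set_system V, [/\ maximal_convex_filter F,
    (\forall v \near F, `|v| <= `|z|) &
    forall f : dual V, (fun v => f v : R^o) @ F --> (z f : R^o)].
Proof.
pose C (s : seq (dual V)) := [set x : V | `|x| <= `|z| /\
  forall f : dual V, f \in s -> `|f x - z f| <= 1].
have conv_le (u v t r : R) : `|u| <= r -> `|v| <= r -> 0 <= t <= 1 ->
    `|t * u + (1 - t) * v| <= r.
  rewrite !ler_norml => /andP[? ?] /andP[? ?] /andP[? ?].
  by apply/andP; split; nra.
have [|F [mF FC]] := @maximal_convex_filter_exists R V [set C s | s in setT].
  split; first by exists (C [::]), [::].
    move=> _ [s _ <-]; split; last first.
      by have [x xs] := goldstine z s ltr01; exists x.
    move=> x y t [xz xs] [yz ys] t01; split.
      apply: le_trans (ler_normD _ _) _; rewrite !normrZ.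
      have /andP[t0 t1] := t01; rewrite !ger0_norm ?subr_ge0//.
      by move: (`|x|) (`|y|) (`|z|) xz yz => ? ? ? ? ?; nra.
    move=> f fs; rewrite linearD !linearZ.
    have -> : t *: f x + (1 - t) *: f y - z f =
        t * (f x - z f) + (1 - t) * (f y - z f).
      by rewrite -[t *: f x]/(t * f x) -[_ *: f y]/(_ * f y); ring.
    by apply: conv_le => //; [exact: xs|exact: ys].
  move=> _ _ [s _ <-] [s' _ <-]; exists (s ++ s') => //.
  apply/seteqP; split=> [x [xz xs]|x [[xz xs] [_ xs']]]; last first.
    by split=> // f; rewrite mem_cat => /orP[/xs|/xs'].
  by split; split=> // f fs; apply: xs; rewrite mem_cat fs ?orbT.
have FF : ProperFilter F by case: mF.
exists F; split=> // [|f].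
  have : F (C [::]) by apply: FC; exists [::].
  by apply: filterS => v [].
apply/cvgrPdistC_le => e e0.
have : F (C [:: e^-1 *: f]) by apply: FC; exists [:: e^-1 *: f].
apply: filterS => v [_ /(_ (e^-1 *: f))]; rewrite mem_head => /(_ isT).
rewrite linearZ -[(e^-1 *: f) v]/(e^-1 *: f v) -scalerBr normrZ normfV.
by rewrite (gtr0_norm e0) mulrC ler_pdivrMr// mul1r.
Qed.

(** * Iterated limits *)

Lemma ler_cvg_filter {T : Type} {R : realType} {F : set_system T}
    {FF : ProperFilter F} (f g : T -> R) (l l' : R) :
  f @ F --> l -> g @ F --> l' -> (\forall x \near F, f x <= g x) -> l <= l'.
Proof.
move=> fl gl fg; rewrite -subr_ge0.
apply: (cvgr_to_ge (F := F) (f := fun x => g x - f x)); first exact: cvgB.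
by apply: filterS fg => x; rewrite subr_ge0.
Qed.

Section iterated_limits.
Context {R : realType} {X : normedModType R} (F : set_system X).

(* [lim_{v_0} ... lim_{v_{n-1}} |x + a_0 v_0 + ... + a_{n-1} v_{n-1}|] along
   [F], the innermost limit being the one over [v_{n-1}]. *)
Fixpoint ilim (n : nat) (a : nat -> R) (x : X) : R :=
  if n is m.+1 then
    lim ((fun v => ilim m (fun i => a i.+1) (x + a 0%N *: v)) @ F)
  else `|x|.

Lemma ilim_ext n a b x : (forall i, (i < n)%N -> a i = b i) ->
  ilim n a x = ilim n b x.
Proof.
elim: n a b x => //= n IH a b x ab.
congr (lim (_ @ F)); apply/funext => v; rewrite ab//.
by apply: IH => i ?; exact: ab.
Qed.

Hypothesis mF : maximal_convex_filter F.
Variable M : R.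
Hypothesis FM : \forall v \near F, `|v| <= M.

#[local] Instance maximal_convex_filter_proper : ProperFilter F.
Proof. by case: mF. Qed.

Let M_ge0 : 0 <= M.
Proof. by have [v vM] := filter_ex FM; exact: le_trans (normr_ge0 v) vM. Qed.

(** The limit at level [n + 1] exists by convexity and boundedness at level [n], so the induction
    carries these properties together. *)
Let sublinear_at n :=
  [/\ forall a b x y,
        ilim n (fun i => a i + b i) (x + y) <= ilim n a x + ilim n b y,
      forall c a x, ilim n (fun i => c * a i) (c *: x) = `|c| * ilim n a x &
      forall a x, 0 <= ilim n a x <= `|x| + M * \sum_(i < n) `|a i| ].

Let step_cvg n a x c : sublinear_at n ->
  cvg ((fun v => ilim n a (x + c *: v)) @ F).
Proof.
move=> [nD nZ nb].
apply: (@convex_function_cvg _ _ _ _ 0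
    (`|x| + `|c| * M + M * \sum_(i < n) `|a i|)) => //.
- move=> u v t /andP[t0 t1].
  have -> : x + c *: (t *: u + (1 - t) *: v) =
      t *: (x + c *: u) + (1 - t) *: (x + c *: v).
    rewrite !scalerDr addrACA -scalerDl [t + _]addrC subrK scale1r.
    by rewrite !scalerA [c * t]mulrC [c * (1 - t)]mulrC.
  (* Splitting [a] and [x] in the proportions [t] and [1 - t] turns joint sublinearity into
     convexity in [v]. *)
  have {1}-> : a = (fun i => t * a i + (1 - t) * a i).
    by apply/funext => i; rewrite -mulrDl addrC subrK mul1r.
  apply: le_trans (nD _ _ _ _) _.
  by rewrite !nZ !ger0_norm// subr_ge0.
- by apply: nearW => v; case/andP: (nb a (x + c *: v)).
- near=> v; have /andP[_ /le_trans->//] := nb a (x + c *: v).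
  rewrite lerD2r (le_trans (ler_normD _ _))// lerD2l normrZ ler_wpM2l//.
  by near: v.
Unshelve. all: by end_near. Qed.

Let sublinear_all n : sublinear_at n.
Proof.
elim: n => [|n IH].
  split=> [a b x y|c a x|a x] /=; first exact: ler_normD.
    exact: normrZ.
  by rewrite big_ord0 mulr0 addr0 normr_ge0/=.
have cv a x c := @step_cvg n a x c IH.
case: IH => nD nZ nb; split=> [a b x y|c a x|a x] /=.
- apply: (ler_cvg_filter (cv _ _ _) (cvgD (cv _ _ _) (cv _ _ _))).
  apply: nearW => v /=; rewrite scalerDl addrACA; exact: nD.
- apply/cvg_lim => //.
  under eq_fun do rewrite -scalerA -scalerDr nZ.
  by apply: cvgMr; exact: cv.
- apply/andP; split.
    apply: limr_ge; first exact: cv.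
    by apply: nearW => v; case/andP: (nb (fun i => a i.+1) (x + a 0%N *: v)).
  apply: limr_le; first exact: cv.
  near=> v; have /andP[_ /le_trans->//] := nb (fun i => a i.+1) (x + a 0%N *: v).
  rewrite big_ord_recl mulrDr addrA lerD2r (le_trans (ler_normD _ _))// lerD2l.
  by rewrite normrZ mulrC ler_wpM2r//; near: v.
Unshelve. all: by end_near. Qed.

Lemma ilimD n a b x y :
  ilim n (fun i => a i + b i) (x + y) <= ilim n a x + ilim n b y.
Proof. by case: (sublinear_all n). Qed.

Lemma ilimZ n c a x : ilim n (fun i => c * a i) (c *: x) = `|c| * ilim n a x.
Proof. by case: (sublinear_all n). Qed.

Lemma ilim_ge0 n a x : 0 <= ilim n a x.
Proof. by case: (sublinear_all n) => _ _ /(_ a x)/andP[]. Qed.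

Lemma ilim_le n a x : ilim n a x <= `|x| + M * \sum_(i < n) `|a i|.
Proof. by case: (sublinear_all n) => _ _ /(_ a x)/andP[]. Qed.

Lemma ilim_cvg n a x c :
  (fun v => ilim n a (x + c *: v)) @ F -->
    lim ((fun v => ilim n a (x + c *: v)) @ F).
Proof. by apply: step_cvg; exact: sublinear_all. Qed.

Lemma ilimS_cvg n a x :
  (fun v => ilim n (fun i => a i.+1) (x + a 0%N *: v)) @ F --> ilim n.+1 a x.
Proof. exact: ilim_cvg. Qed.

(** By subadditivity a difference of values is at most the value at the differences, which [ilim_le]
    bounds. *)
Lemma ilim_lipschitz n a b x y :
  `|ilim n a x - ilim n b y| <= `|x - y| + M * \sum_(i < n) `|a i - b i|.
Proof.
have le a' b' x' y' : ilim n a' x' - ilim n b' y' <=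
    `|x' - y'| + M * \sum_(i < n) `|a' i - b' i|.
  have := ilimD n (fun i => a' i - b' i) b' (x' - y') y'.
  rewrite subrK; have -> : (fun i => a' i - b' i + b' i) = a'.
    by apply/funext => i; rewrite subrK.
  by rewrite lerBlDr => /le_trans; apply; rewrite lerD2r; exact: ilim_le.
rewrite ler_norml le andbT lerNl opprB distrC.
by under eq_bigr do rewrite distrC.
Qed.

(** Inner limits with zero coefficients are limits of constants. Thus [ilim] at base point [0] is
    well defined on finitely supported sequences. *)
Lemma ilim_pad n k a x : (forall i, (n <= i)%N -> a i = 0) ->
  ilim (n + k) a x = ilim n a x.
Proof.
elim: n a x => [|n IH] a x a0; last first.
  rewrite addSn /=; congr (lim (_ @ F)); apply/funext => v.
  by apply: IH => i ?; exact: a0.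
rewrite add0n; elim: k a x a0 => //= k IH a x a0.
apply/cvg_lim => //.
have -> : (fun v => ilim k (fun i => a i.+1) (x + a 0%N *: v)) = cst `|x|.
  apply/funext => v; rewrite a0// scale0r addr0 IH// => i _; exact: a0.
exact: cvg_cst.
Qed.

End iterated_limits.

(** * Merging convex blocks of coefficients *)

Section convex_blocks.
Context {R : realType} {X : normedModType R} (F : set_system X).
Hypothesis mF : maximal_convex_filter F.
Variable M : R.
Hypothesis FM : \forall v \near F, `|v| <= M.
Let FF : ProperFilter F := maximal_convex_filter_proper mF.
Existing Instance FF.

Definition scons (c : R) (a : nat -> R) (i : nat) : R :=
  if i is j.+1 then a j else c.

Lemma ilimS_scons n c a x :
  ilim F n.+1 (scons c a) x = lim ((fun v => ilim F n a (x + c *: v)) @ F).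
Proof. by []. Qed.

Lemma ilim_scons0 n a x : ilim F n.+1 (scons 0 a) x = ilim F n a x.
Proof.
apply/cvg_lim => //=; under eq_fun do rewrite scale0r addr0.
exact: cvg_cst.
Qed.

(* Some convex member of [F] makes [v |-> ilim F n a (x + b (c1 + c2) v)]
   nearly constant; it contains the barycentre of any two of its points. *)
Lemma ilim_merge n (b c1 c2 : R) a x : 0 <= c1 -> 0 <= c2 ->
  ilim F n.+2 (scons (b * c1) (scons (b * c2) a)) x =
  ilim F n.+1 (scons (b * (c1 + c2)) a) x.
Proof.
move=> c10 c20.
have := addr_ge0 c10 c20; rewrite le_eqVlt => /predU1P[c0|c0].
  have : c1 = 0 /\ c2 = 0 by lra.
  by move=> [-> ->]; rewrite addr0 !mulr0 !ilim_scons0.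
apply/eqP; rewrite -subr_eq0 -normr_le0; apply/ler_addgt0Pr => e e0.
rewrite add0r.
have := @ilim_cvg _ _ F mF M FM n a x (b * (c1 + c2)).
move=> /cvgr_distC_le/(_ _ e0).
case: (mF) => _ Fconv _ /Fconv [C [FC cC Ce]].
set l := ilim F n.+1 _ x.
have in2 v : C v ->
    `|ilim F n.+1 (scons (b * c2) a) (x + (b * c1) *: v) - l| <= e.
  move=> Cv; apply: (cvgr_to_le (F := F) (f := fun w =>
      `|ilim F n a (x + (b * c1) *: v + (b * c2) *: w) - l|)).
    by apply: cvg_norm; apply: cvgB; [exact: (ilim_cvg mF FM)|exact: cvg_cst].
  apply: filterS FC => w Cw.
  (* With this weight, [b * c1] times [v] plus [b * c2] times [w] is [b * (c1 + c2)] times a point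
     of [C]. *)
  pose t := c1 / (c1 + c2).
  have t01 : 0 <= t <= 1.
    by apply/andP; split; [exact: divr_ge0 (ltW c0)|rewrite ler_pdivrMr// mul1r lerDl].
  have tE : 1 - t = c2 / (c1 + c2).
    by rewrite /t -{1}(divff (lt0r_neq0 c0)) -mulrBl addrAC subrr add0r.
  have := Ce _ (cC v w t Cv Cw t01).
  have c_neq0 : c1 + c2 != 0 by exact: lt0r_neq0.
  have e1 : b * (c1 + c2) * t = b * c1 by rewrite /t; field.
  have e2 : b * (c1 + c2) * (1 - t) = b * c2 by rewrite tE; field.
  by rewrite /= scalerDr !scalerA e1 e2 addrA.
apply: (cvgr_to_le (F := F) (f := fun v =>
  `|ilim F n.+1 (scons (b * c2) a) (x + (b * c1) *: v) - l|)).
  by apply: cvg_norm; apply: cvgB; [exact: (ilim_cvg mF FM)|exact: cvg_cst].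
by apply: filterS FC => v /in2.
Qed.

(** The block collapses from the inside out: the induction hypothesis merges its tail under the
    first limit, and [ilim_merge] absorbs the head. *)
Lemma ilim_block p n b (c a : nat -> R) x : (forall i, 0 <= c i) ->
  (forall i, (i < p)%N -> a i = b * c i) ->
  ilim F (p + n) a x =
  ilim F n.+1 (scons (b * \sum_(i < p) c i) (fun i => a (p + i)%N)) x.
Proof.
elim: p c a x => [|p IH] c a x c0 abc.
  by rewrite big_ord0 mulr0 ilim_scons0.
rewrite addSn -[LHS]/(lim ((fun v => ilim F (p + n) (fun i => a i.+1)
  (x + a 0%N *: v)) @ F)).
have -> : (fun v => ilim F (p + n) (fun i => a i.+1) (x + a 0%N *: v)) =
    (fun v => ilim F n.+1 (scons (b * \sum_(i < p) c i.+1)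
      (fun i => a (p.+1 + i)%N)) (x + a 0%N *: v)).
  apply/funext => v; rewrite (IH (fun i => c i.+1))//.
  by move=> i ip; exact: abc.
rewrite -ilimS_scons abc// ilim_merge//; last exact: sumr_ge0.
by rewrite big_ord_recl.
Qed.

End convex_blocks.

(** * Lower bounds and the basis constant *)

Section lower_bounds.
Context {R : realType} {X : normedModType R} (F : set_system X).
Hypothesis mF : maximal_convex_filter F.
Variable M : R.
Hypothesis FM : \forall v \near F, `|v| <= M.
Let FF : ProperFilter F := maximal_convex_filter_proper mF.
Existing Instance FF.
Variable z : dual (dual X).
Hypothesis Fz : forall f : dual X, (fun v => f v : R^o) @ F --> (z f : R^o).

(** Since [f v] tends to [z f], each limit in turn replaces one vector by [z] under [f]. *)
Lemma ilim_ge_functional n (a : nat -> R) x (f : dual X) :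
  `|f x + (\sum_(i < n) a i) *: z f| <= `|f| * ilim F n a x.
Proof.
elim: n a x => [|n IH] a x.
  by rewrite big_ord0 scale0r addr0; exact: dual_norm_apply.
apply: (ler_cvg_filter (F := F)
  (f := fun v => `|f (x + a 0%N *: v) + (\sum_(i < n) a i.+1) *: z f|)
  (g := fun v => `|f| * ilim F n (fun i => a i.+1) (x + a 0%N *: v))).
- apply: cvg_norm; rewrite big_ord_recl /= scalerDl addrA.
  under eq_fun do rewrite linearD linearZ.
  apply: cvgD; last exact: cvg_cst.
  by apply: cvgD; [exact: cvg_cst|apply: cvgZr; exact: Fz].
- by apply: cvgMr; exact: (ilimS_cvg mF FM).
- by apply: nearW => v; exact: IH.
Qed.

Lemma ilim_ge_bidual n (a : nat -> R) x :
  `|canonical_embedding x + (\sum_(i < n) a i) *: z| <= ilim F n a x.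
Proof.
apply: dual_norm_le => f f1.
rewrite -[X in `|X|]/(f x + (\sum_(i < n) a i) *: z f).
apply: le_trans (ilim_ge_functional _ _ _ _) _.
by rewrite ler_piMl// (ilim_ge0 mF FM).
Qed.

Variable d : R.
Hypothesis d0 : 0 < d.
Hypothesis zd : forall x, d <= `|canonical_embedding x + z|.

Lemma ilim_ge_sum n (a : nat -> R) x : d * `|\sum_(i < n) a i| <= ilim F n a x.
Proof.
apply: le_trans (ilim_ge_bidual n a x).
set s := \sum_(i < n) _.
have [->|s0] := eqVneq s 0; first by rewrite normr0 mulr0.
have -> : canonical_embedding x + s *: z =
    s *: (canonical_embedding (s^-1 *: x) + z).
  by rewrite linearZ scalerDr scalerA mulfV// scale1r.
by rewrite normrZ mulrC ler_wpM2l.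
Qed.

(** With [s] the sum of the coefficients, [x] is [(x + s z) - s z] in the bidual. The first term is
    bounded by [ilim_ge_bidual], the second by [ilim_ge_sum], which contributes [|z| / d]. *)
Lemma norm_le_ilim n (a : nat -> R) x : `|x| <= (1 + `|z| / d) * ilim F n a x.
Proof.
have h := ilim_ge_bidual n a x; have hs := ilim_ge_sum n a x.
set s := \sum_(i < n) a i in h hs.
rewrite mulrDl mul1r -canonical_embedding_norm.
rewrite -[X in `|X|](addrK (s *: z)) (le_trans (ler_normB _ _))// lerD//.
rewrite normrZ mulrC -mulrA ler_wpM2l// mulrC ler_pdivlMr// mulrC//.
Qed.

(** The bound [norm_le_ilim] handles the [k] inner limits and is preserved by the [n] outer ones. *)
Lemma ilim_basis n k a x :
  ilim F n a x <= (1 + `|z| / d) * ilim F (n + k) a x.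
Proof.
elim: n a x => [|n IH] a x; first exact: norm_le_ilim.
rewrite addSn; apply: (ler_cvg_filter (F := F)
  (g := fun v => (1 + `|z| / d) * ilim F (n + k) (fun i => a i.+1) (x + a 0%N *: v))).
- exact: (ilimS_cvg mF FM).
- by apply: cvgMr; exact: (ilimS_cvg mF FM).
- by apply: nearW => v; exact: IH.
Qed.

End lower_bounds.

(** * The spreading sequence *)

Lemma le_mx_entry_norm {R : realType} m n (A : 'M[R]_(m, n)) i j : `|A i j| <= `|A|.
Proof.
rewrite -[leRHS]/(mx_norm A) mx_normrE; apply/bigmax_geP; right => /=.
by exists (i, j).
Qed.

Section uniform_approximation.
Context {R : realType} {X : normedModType R} (F : set_system X).
Hypothesis mF : maximal_convex_filter F.
Variable M : R.
Hypothesis FM : \forall v \near F, `|v| <= M.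
Let FF : ProperFilter F := maximal_convex_filter_proper mF.
Existing Instance FF.

Let M_ge0 : 0 <= M.
Proof. by have [v vM] := filter_ex FM; exact: le_trans (normr_ge0 v) vM. Qed.

Lemma ilim_uniform_approx (k n : nat) (w : nat -> X) (e : R) : 0 < e ->
  \forall v \near F, forall b a : nat -> R,
    (forall i, `|b i| <= 1) -> (forall i, `|a i| <= 1) ->
    `|ilim F n (fun i => a i.+1) (\sum_(l < k) b l *: w l + a 0%N *: v)
      - ilim F n.+1 a (\sum_(l < k) b l *: w l)| <= e.
Proof.
move=> e0.
pose vec (t : 'rV[R]_(k + n.+1)) := \sum_(l < k) t ord0 (lshift n.+1 l) *: w l.
(* Indices beyond [n] are sent to [0] by [inord]; [ilim_ext] discards the values there. *)
pose coef (t : 'rV[R]_(k + n.+1)) i := t ord0 (rshift k (inord i : 'I_n.+1)).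
pose h v t := ilim F n (fun i => coef t i.+1) (vec t + coef t 0%N *: v)
  - ilim F n.+1 (coef t) (vec t).
pose W := \sum_(l < k) `|w l|.
have W0 : 0 <= W by exact: sumr_ge0.
(* Each of the two terms of [h v] has Lipschitz constant [W + M * n.+1] when [|v| <= M]; in the
   first, one [M] comes from [coef t 0 *: v]. *)
pose c := 2 * (W + M * n.+1%:R).
have c0 : 0 <= c by rewrite mulr_ge0// addr_ge0// mulr_ge0.
have coefB t t' i : `|coef t i - coef t' i| <= `|t - t'|.
  by have := le_mx_entry_norm (t - t') ord0 (rshift k (inord i : 'I_n.+1)); rewrite !mxE.
have vecB t t' : `|vec t - vec t'| <= W * `|t - t'|.
  rewrite -sumrB mulr_suml (le_trans (ler_norm_sum _ _ _))// ler_sum// => l _.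
  rewrite -scalerBl normrZ mulrC ler_wpM2l//.
  by have := le_mx_entry_norm (t - t') ord0 (lshift n.+1 l); rewrite !mxE.
have sumB m t t' (s : nat -> nat) :
    \sum_(i < m) `|coef t (s i) - coef t' (s i)| <= m%:R * `|t - t'|.
  apply: (@le_trans _ _ (\sum_(i < m) `|t - t'|)).
    by apply: ler_sum => i _; exact: coefB.
  by rewrite sumr_const card_ord mulr_natl.
have hB v t t' : `|v| <= M -> `|h v t - h v t'| <= c * `|t - t'|.
  move=> vM.
  have tri (p q p' q' : R) : `|p - q - (p' - q')| <= `|p - p'| + `|q - q'|.
    by rewrite (_ : _ - _ = (p - p') - (q - q')) ?ler_normB//; ring.
  apply: le_trans (tri _ _ _ _) _.
  have h1 := ilim_lipschitz mF FM n (fun i => coef t i.+1)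
    (fun i => coef t' i.+1) (vec t + coef t 0%N *: v) (vec t' + coef t' 0%N *: v).
  have h2 := ilim_lipschitz mF FM n.+1 (coef t) (coef t') (vec t) (vec t').
  have v1 : `|vec t + coef t 0%N *: v - (vec t' + coef t' 0%N *: v)| <=
      W * `|t - t'| + M * `|t - t'|.
    rewrite opprD addrACA (le_trans (ler_normD _ _))// lerD// -scalerBl normrZ.
    by rewrite mulrC ler_pM.
  have v2 := vecB t t'.
  have s1 := ler_wpM2l M_ge0 (sumB n t t' S).
  have s2 := ler_wpM2l M_ge0 (sumB n.+1 t t' id).
  rewrite -natr1 in s2; rewrite /c -natr1.
  apply: le_trans (lerD h1 h2) _.
  apply: le_trans (lerD (lerD v1 s1) (lerD v2 s2)) _.
  by rewrite le_eqVlt; apply/orP; left; apply/eqP; ring.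
(* The convergence defining [ilim F n.+1] is uniformly Lipschitz in the
   coefficients, hence uniform on the compact cube. *)
have cube_compact : compact [set t : 'rV[R]_(k + n.+1) |
    forall i, `[-1, 1]%classic (t ord0 i)].
  by apply: (@rV_compact R^o _ (fun=> `[-1, 1]%classic)) => i; exact: segment_compact.
have near0 t : \forall v \near F, `|h v t| <= e / 2.
  have := @ilimS_cvg _ _ F mF M FM n (coef t) (vec t).
  by move=> /cvgr_distC_le/(_ _ (divr_gt0 e0 (ltr0n _ 2))).
have : \forall v \near F,
    [set t : 'rV[R]_(k + n.+1) | forall i, `[-1, 1]%classic (t ord0 i)]
    `<=` [set t | `|h v t| <= e].
  move/compact_near_coveringP: cube_compact; apply => t _.
  (* Then [c * d <= e / 2]; adding [1] avoids dividing by zero. *)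
  pose d := e / 2 / (c + 1).
  have d0 : 0 < d by rewrite !divr_gt0// ltr_wpDl.
  exists ([set t' | `|t - t'| < d], [set v | `|v| <= M /\ `|h v t| <= e / 2]).
    split=> /=; last exact: (filterI FM (near0 t)).
    by apply/nbhs_ballP; exists d; [exact: d0|move=> t'; rewrite -ball_normE].
  move=> [t' v] /= [tt' [vM hv]].
  rewrite -(subrK (h v t) (h v t')) (le_trans (ler_normD _ _))//.
  rewrite [leRHS]splitr lerD// distrC (le_trans (hB _ _ _ vM))//.
  apply: (@le_trans _ _ (c * d)); first by rewrite ler_wpM2l// ltW.
  rewrite /d mulrA ler_pdivrMr ?ltr_wpDl// mulrC.
  by rewrite ler_wpM2l ?lerDl// ltW// divr_gt0.
apply: filterS => v hv b a b1 a1.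
pose t : 'rV[R]_(k + n.+1) := row_mx (\row_l b l) (\row_j a j).
have vt : vec t = \sum_(l < k) b l *: w l.
  by apply: eq_bigr => l _; rewrite row_mxEl mxE.
have ct i : (i < n.+1)%N -> coef t i = a i.
  by move=> i_n; rewrite /coef row_mxEr mxE inordK.
have : `|h v t| <= e.
  apply: hv => i; rewrite /t; case: (split_ordP i) => j ->.
    by rewrite row_mxEl mxE /= in_itv/= -ler_norml.
  by rewrite row_mxEr mxE /= in_itv/= -ler_norml.
rewrite /h vt ct//.
rewrite (@ilim_ext _ _ F n (fun i => coef t i.+1) (fun i => a i.+1))//; last first.
  by move=> i i_n; rewrite ct.
by rewrite (@ilim_ext _ _ F n.+1 (coef t) a).
Qed.

End uniform_approximation.

(** Links the finite families of the definitions to the sequences on which [ilim] operates. *)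
Definition extend_ord {T : Type} (d : T) n (f : 'I_n -> T) (i : nat) : T :=
  oapp f d (insub i).

Lemma extend_ordE {T : Type} (d : T) n (f : 'I_n -> T) (i : 'I_n) :
  extend_ord d f i = f i.
Proof. by rewrite /extend_ord valK. Qed.

Section spreading.
Context {R : realType} {X : normedModType R} (F : set_system X).
Hypothesis mF : maximal_convex_filter F.
Variable M : R.
Hypothesis FM : \forall v \near F, `|v| <= M.
Let FF : ProperFilter F := maximal_convex_filter_proper mF.
Existing Instance FF.

Definition unit_combination (w : nat -> X) k : set X :=
  [set x | exists2 b : nat -> R, (forall i, `|b i| <= 1) &
    x = \sum_(l < k) b l *: w l].

Lemma unit_combination_widen w k k' x : (k <= k')%N ->
  unit_combination w k x -> unit_combination w k' x.
Proof.
move=> kk' [b b1 ->]; exists (fun i => if (i < k)%N then b i else 0).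
  by move=> i; case: ifP => // _; rewrite normr0.
rewrite -(subnKC kk') big_split_ord /= [X in _ + X]big1 => [|i _]; last first.
  by rewrite ltnNge leq_addr scale0r.
by rewrite addr0; apply: eq_bigr => i _; rewrite ltn_ord.
Qed.

Lemma unit_combinationS w k x (c : R) : `|c| <= 1 ->
  unit_combination w k x -> unit_combination w k.+1 (x + c *: w k).
Proof.
move=> c1 [b b1 ->]; exists (fun i => if (i < k)%N then b i else c).
  by move=> i; case: ifP.
rewrite big_ord_recr /= ltnn; congr (_ + _).
by apply: eq_bigr => i _; rewrite ltn_ord.
Qed.

(** Given the earlier terms, [ilim_uniform_approx] yields a next term good for all their unit
    combinations as base points and for the finitely many lengths [n <= k]. *)
Lemma approximating_sequence_exists : exists w : nat -> X,
  (forall k, `|w k| <= M) /\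
  forall k n x (a : nat -> R), (n <= k)%N -> unit_combination w k x ->
    (forall i, `|a i| <= 1) ->
    `|ilim F n (fun i => a i.+1) (x + a 0%N *: w k) - ilim F n.+1 a x|
      <= k.+1%:R^-1.
Proof.
pose good (s : seq X) v := `|v| <= M /\
  forall (n : 'I_(size s).+1) (b a : nat -> R),
    (forall i, `|b i| <= 1) -> (forall i, `|a i| <= 1) ->
    `|ilim F n (fun i => a i.+1)
        (\sum_(l < size s) b l *: nth 0 s l + a 0%N *: v)
      - ilim F n.+1 a (\sum_(l < size s) b l *: nth 0 s l)| <= (size s).+1%:R^-1.
have /choice[g hg] s : exists v, good s v.
  apply: (@filter_ex _ F); apply: (filterI FM); apply: filter_forall => n.
  by apply: (ilim_uniform_approx mF FM); rewrite invr_gt0.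
(* Each choice depends on all earlier ones, so the recursion builds the list of chosen terms. *)
pose hist := fix hist k := if k is k'.+1 then rcons (hist k') (g (hist k')) else [::].
pose w k := g (hist k).
have histE k : hist k = mkseq w k by elim: k => // k IH; rewrite mkseqS -IH.
have hw k : good (mkseq w k) (w k) by rewrite -histE; exact: hg.
exists w; split=> [k|k n x a nk [b b1 ->] a1]; first by case: (hw k).
have := hw k; rewrite /good size_mkseq => -[_ /(_ (Ordinal (nk : (n < k.+1)%N)) b a b1 a1)].
have -> : \sum_(l < k) b l *: nth 0 (mkseq w k) l = \sum_(l < k) b l *: w l.
  by apply: eq_bigr => l _; rewrite nth_mkseq.
exact.
Qed.

(** The limits are replaced by actual terms one at a time, from the outermost, at a cost of at most
    [N.+1%:R^-1] each. The index [k0] bounds the terms already absorbed in the base point [x]. *)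
Lemma approximating_sequence_spreads (w : nat -> X) N n k0 (k : nat -> nat) x
    (a : nat -> R) :
  (forall k n x (a : nat -> R), (n <= k)%N -> unit_combination w k x ->
    (forall i, `|a i| <= 1) ->
    `|ilim F n (fun i => a i.+1) (x + a 0%N *: w k) - ilim F n.+1 a x|
      <= k.+1%:R^-1) ->
  (n <= N)%N -> (forall i, (i < n)%N -> (k0 <= k i)%N && (N <= k i)%N) ->
  (forall i j, (i < j)%N -> (j < n)%N -> (k i < k j)%N) ->
  unit_combination w k0 x -> (forall i, `|a i| <= 1) ->
  `| `|x + \sum_(i < n) a i *: w (k i)| - ilim F n a x| <= n%:R * N.+1%:R^-1.
Proof.
move=> approx; elim: n k0 k x a => [|n IH] k0 k x a nN kN kinc xk a1.
  by rewrite big_ord0 addr0 subrr normr0 mul0r.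
rewrite big_ord_recl addrA -(subrKA (ilim F n (fun i => a i.+1) (x + a 0%N *: w (k 0%N)))).
rewrite (le_trans (ler_normD _ _))// -natr1 mulrDl mul1r lerD//.
  apply: (IH (k 0%N).+1 (fun i => k i.+1)) => //; first exact: ltnW.
  - by move=> i i_n; rewrite kinc//=; case/andP: (kN i.+1 i_n).
  - by move=> i j ij jn; exact: kinc.
  - apply: unit_combinationS => //; apply: unit_combination_widen xk.
    by case/andP: (kN 0%N isT).
have /andP[k0k Nk] := kN 0%N isT.
apply: le_trans (approx _ _ _ _ _ _ a1) _.
- by rewrite (leq_trans _ Nk)// ltnW.
- exact: unit_combination_widen xk.
- by rewrite lef_pV2 ?posrE// ler_nat.
Qed.

Lemma spreading_sequence_exists : exists w : nat -> X,
  (forall k, `|w k| <= M) /\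
  forall n (eps : R), 0 < eps -> exists n0 : nat, forall k : 'I_n -> nat,
    (forall i, (n0 <= k i)%N) ->
    (forall i j : 'I_n, (i < j)%N -> (k i < k j)%N) ->
    forall a : 'I_n -> R, (forall i, -1 <= a i <= 1) ->
    `| `|\sum_(i < n) a i *: w (k i)| - ilim F n (extend_ord 0 a) 0| < eps.
Proof.
have [w [wM approx]] := approximating_sequence_exists.
exists w; split=> // n eps eps0.
(* The first bound allows [n] limits at every index from [N] on, the second makes the total error
   less than [eps]. *)
pose N := maxn n (Num.bound (n%:R / eps)).
have Neps : n%:R * N.+1%:R^-1 < eps.
  rewrite ltr_pdivrMr// mulrC -ltr_pdivrMr//.
  apply: lt_le_trans (archi_boundP _) _; first by rewrite divr_ge0// ltW.
  by rewrite ler_nat leqW// leq_maxr.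
exists N => k kN kinc a a1; apply: le_lt_trans Neps.
have -> : \sum_(i < n) a i *: w (k i) =
    0 + \sum_(i < n) extend_ord 0 a i *: w (extend_ord 0%N k i).
  by rewrite add0r; apply: eq_bigr => i _; rewrite !extend_ordE.
apply: (@approximating_sequence_spreads w N n 0%N) => //.
- exact: leq_maxl.
- by move=> i i_n; rewrite (extend_ordE 0%N k (Ordinal i_n)) kN.
- move=> i j ij jn; have i_n := ltn_trans ij jn.
  by rewrite (extend_ordE 0%N k (Ordinal i_n)) (extend_ordE 0%N k (Ordinal jn)) kinc.
- by exists (fun=> 0); [move=> ?; rewrite normr0|rewrite big_ord0].
- move=> i; rewrite /extend_ord; case: insubP => [j _ _|_] /=.
    by rewrite ler_norml.
  by rewrite normr0.
Qed.

End spreading.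

(** * The space spanned by the spreading model *)

Section renorming.
Context {R : realType} {V : lmodType R} (p : seminorm V).
Hypothesis p_definite : forall u, p u = 0 -> u = 0.

(* The proof argument is a phantom: it carries the norm of the copy of [V]. *)
Definition normed_by of (forall u, p u = 0 -> u = 0) : Type := V.
HB.instance Definition _ := GRing.Lmodule.on (normed_by p_definite).
HB.instance Definition _ := Lmodule_isNormed.Build R (normed_by p_definite)
  (seminorm_triangle p) (seminorm_scale p) p_definite.

Lemma seminorm_completion : exists (E : completeNormedModType R)
  (i : {linear V -> E}), forall v, `|i v| = p v.
Proof.
have [E [i iE]] := completion_exists (normed_by p_definite).
by exists E, i => v; exact: iE.
Qed.

End renorming.

(** * Grunblum's criterion for basic sequences *)

Section basis_criterion.
Context {R : realType} {E : completeNormedModType R} (e : nat -> E).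
Variables (K c : R).
Hypothesis c0 : 0 < c.
Hypothesis ce : forall i, c <= `|e i|.
Hypothesis basis_constant : forall (m n : nat) (a : nat -> R), (m <= n)%N ->
  `|\sum_(i < m) a i *: e i| <= K * `|\sum_(i < n) a i *: e i|.

Let partial (a : nat -> R) n := \sum_(i < n) a i *: e i.

Let partialB a b n : partial (fun i => a i - b i) n = partial a n - partial b n.
Proof. by rewrite -sumrB; apply: eq_bigr => i _; rewrite scalerBl. Qed.

Let partialS a n : partial a n.+1 = partial a n + a n *: e n.
Proof. by rewrite /partial big_ord_recr. Qed.

Let partial_series a : series (fun i => a i *: e i) = partial a.
Proof. by apply/funext => n; rewrite /series /= big_mkord. Qed.

(** The term [a i *: e i] is a difference of two partial sums, each controlled by [K], and
    [|e i| >= c]. *)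
Let coef_le (a : nat -> R) i n : (i < n)%N ->
  `|a i| <= 2 * K / c * `|partial a n|.
Proof.
move=> i_n; rewrite mulrAC ler_pdivlMr//.
apply: (@le_trans _ _ (`|a i *: e i|)); first by rewrite normrZ ler_wpM2l.
have -> : a i *: e i = partial a i.+1 - partial a i.
  by rewrite partialS addrAC subrr add0r.
have h1 := basis_constant a i_n; have h2 := basis_constant a (ltnW i_n).
apply: le_trans (ler_normB _ _) _.
by apply: le_trans (lerD h1 h2) _; rewrite /partial; lra.
Qed.

Let K0 : 0 <= K.
Proof.
have := basis_constant (fun=> 1) (leqnn 1).
rewrite -[leLHS]mul1r -subr_ge0 -mulrBl pmulr_lge0 ?subr_ge0; first exact: le_trans.
by rewrite normr_gt0 big_ord1 scale1r -normr_gt0 (lt_le_trans c0).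
Qed.

(** Partial sums for [a - b] tend to [0], and the basis constant bounds every fixed one by [K] times
    the later ones; so all vanish. *)
Let partial_unique a b (v : E) : partial a @ \oo --> v -> partial b @ \oo --> v -> a = b.
Proof.
move=> av bv; pose d i := a i - b i.
have d_cvg : partial d @ \oo --> (0 : E).
  rewrite -(subrr v); have -> : partial d = partial a - partial b.
    by apply/funext => n; exact: partialB.
  exact: cvgB.
have pd m : partial d m = 0.
  apply/eqP; rewrite -normr_le0 -(mulr0 K) -(normr0 E).
  apply: (cvgr_to_ge (F := \oo) (f := fun n => K * `|partial d n|)).
    by apply: cvgMr; exact: cvg_norm.
  by near=> n; apply: basis_constant; near: n; exact: nbhs_infty_ge.
apply/funext => i; apply/eqP; rewrite -subr_eq0.
have /eqP : d i *: e i = 0 by have := partialS d i; rewrite !pd add0r.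
rewrite scaler_eq0 => /orP[//|ei0].
by have := lt_le_trans c0 (ce i); rewrite (eqP ei0) normr0 ltxx.
Unshelve. all: by end_near. Qed.

Let span_approx v : closure (seq_span e) v -> forall eps : R, 0 < eps ->
  exists (n : nat) (a : nat -> R),
    forall m, (n <= m)%N -> `|v - partial a m| < eps.
Proof.
move=> cv eps eps0.
have [_ [[n [a ->]]]] := cv _ (nbhsx_ballx v _ eps0).
rewrite -ball_normE /= => va.
(* Extension by zero makes the partial sums constant from [n] on. *)
exists n, (extend_ord 0 a) => m nm.
suff -> : partial (extend_ord 0 a) m = \sum_(i < n) a i *: e i by [].
rewrite /partial -(subnKC nm) big_split_ord /= [X in _ + X]big1 => [|i _].
  by rewrite addr0; apply: eq_bigr => i _; rewrite extend_ordE.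
by rewrite /extend_ord insubF/= ?scale0r// ltnNge leq_addr.
Qed.

Let partial_cvg (a : nat -> nat -> R) (b : nat -> R) m :
  (forall i, (fun j => a j i) @ \oo --> b i) ->
  (fun j => partial (a j) m) @ \oo --> partial b m.
Proof.
move=> ab; elim: m => [|m IH].
  by rewrite /partial big_ord0; under eq_fun do rewrite big_ord0; exact: cvg_cst.
rewrite partialS; under eq_fun do rewrite partialS.
by apply: cvgD => //; apply: cvgZl; exact: ab.
Qed.

(** The coefficients of finite combinations approaching [v] are Cauchy by [coef_le]; their limits
    are the coefficients of [v]. *)
Lemma schauder_basic_criterion : schauder_basic_sequence e.
Proof.
move=> v cv.
have /choice[a /choice[N aN]] (j : nat) : exists (a : nat -> R) (N : nat),
    forall m, (N <= m)%N -> `|v - partial a m| < j.+1%:R^-1.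
  have [|n [a an]] := span_approx cv (eps := j.+1%:R^-1).
    by rewrite invr_gt0.
  by exists a, n.
have small (r eps : R) : 0 <= r -> 0 < eps -> \forall j \near \oo, r * j.+1%:R^-1 <= eps.
  move=> r0 eps0; near=> j.
  rewrite ler_pdivrMr// mulrC -ler_pdivrMr//.
  apply: (@le_trans _ _ (Num.bound (r / eps))%:R).
    by apply/ltW/archi_boundP; rewrite divr_ge0// ltW.
  by rewrite ler_nat leqW//; near: j; exact: nbhs_infty_ge.
(* The index [n] may exceed any [m], as needed for applying [coef_le] and [basis_constant]. *)
have close j l m : (j <= l)%N ->
    exists2 n, (m <= n)%N & `|partial (fun i => a j i - a l i) n| <= 2 * j.+1%:R^-1.
  move=> jl; exists (maxn m (maxn (N j) (N l))); first exact: leq_maxl.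
  rewrite partialB; set n := maxn _ _.
  have -> : partial (a j) n - partial (a l) n =
      (v - partial (a l) n) - (v - partial (a j) n).
    by rewrite opprB [RHS]addrC addrA subrK.
  rewrite (le_trans (ler_normB _ _))// mulr_natl mulr2n lerD//.
    apply: (@le_trans _ _ l.+1%:R^-1); last by rewrite lef_pV2 ?posrE// ler_nat.
    by apply/ltW/aN; rewrite !leq_max leqnn !orbT.
  by apply/ltW/aN; rewrite !leq_max leqnn !orbT.
have coef_cvg i : cvg ((fun j => a j i : R^o) @ \oo).
  apply: cauchy_cvg; apply: cauchy_exP => eps eps0.
  pose r := 2 * K / c * 2.
  have r0 : 0 <= r by rewrite !mulr_ge0// invr_ge0 ltW.
  have [J _ hJ] := small r (eps / 2) r0 (divr_gt0 eps0 (ltr0n _ 2)).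
  exists (a J i); exists J => // l Jl; rewrite -ball_normE /=.
  have [n i_n an] := close J l i.+1 Jl.
  apply: (@le_lt_trans _ _ (r * J.+1%:R^-1)).
    rewrite /r -mulrA.
    apply: le_trans (@coef_le (fun i => a J i - a l i) i n i_n) _.
    rewrite ler_wpM2l//.
    by rewrite !mulr_ge0// invr_ge0 ltW.
  apply: le_lt_trans (hJ J _) _ => /=; first exact: leqnn.
  by rewrite ltr_pdivrMr// mulr_natr mulr2n ltrDl.
pose b i : R := lim ((fun j => a j i : R^o) @ \oo).
(* The bound is uniform in [m], which permits exchanging the limits in [j] and [m] below. *)
have ab m j : `|partial (a j) m - partial b m| <= K * (2 * j.+1%:R^-1).
  apply: (cvgr_to_le (F := \oo) (f := fun l => `|partial (a j) m - partial (a l) m|)).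
    apply: cvg_norm; apply: cvgB; first exact: cvg_cst.
    by apply: partial_cvg => i; exact: coef_cvg.
  near=> l.
  have jl : (j <= l)%N by near: l; exact: nbhs_infty_ge.
  have [n mn an] := close j l m jl.
  rewrite -partialB; apply: le_trans (basis_constant _ mn) _.
  by rewrite ler_wpM2l.
have bv : partial b @ \oo --> v.
  apply/cvgrPdist_le => eps eps0.
  have r0 : 0 <= K * 2 + 1 by rewrite addr_ge0// mulr_ge0.
  have [J _ hJ] := small _ _ r0 eps0.
  near=> m.
  apply: le_trans (hJ J (leqnn J)).
  rewrite -(subrKA (partial (a J) m)) (le_trans (ler_normD _ _))//.
  rewrite mulrDl mul1r addrC lerD//; first by rewrite -mulrA; exact: ab.
  by apply/ltW/aN; near: m; exact: nbhs_infty_ge.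
exists b; split=> [|b']; rewrite partial_series//.
exact: partial_unique.
Unshelve. all: by end_near. Qed.

End basis_criterion.

Lemma big_seq_interval {V : zmodType} (s : seq nat) (p q : nat) (g : nat -> V) :
  uniq s -> (forall i, i \in s -> (p <= i < q)%N) ->
  \sum_(p <= i < q) (if i \in s then g i else 0) = \sum_(i <- s) g i.
Proof.
move=> us spq; rewrite -big_mkcond -big_filter; apply: perm_big.
apply: uniq_perm => //; first by rewrite filter_uniq// iota_uniq.
move=> i; rewrite mem_filter mem_index_iota.
by apply/andP/idP => [[]//|is_]; split=> //; exact: spq.
Qed.

(** * Homogeneity under convex blocks *)

Section homogeneity.
Context {R : realType} {X : normedModType R} (F : set_system X).
Hypothesis mF : maximal_convex_filter F.
Variable M : R.
Hypothesis FM : \forall v \near F, `|v| <= M.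

(** By [ilim_block], each interval between consecutive values of [m] collapses to the single
    coefficient [a k], its weights having sum [1]. *)
Lemma ilim_blocks (m : nat -> nat) (C : nat -> nat -> R) (B a : nat -> R) n k x :
  (forall k, (m k <= m k.+1)%N) -> (forall k i, 0 <= C k i) ->
  (forall k, \sum_(m k <= i < m k.+1) C k i = 1) ->
  (forall k i, (m k <= i < m k.+1)%N -> B i = a k * C k i) ->
  ilim F (m (k + n)%N - m k)%N (fun i => B (m k + i)%N) x =
  ilim F n (fun i => a (k + i)%N) x.
Proof.
move=> mS C0 C1 BC; elim: n k x => [|n IH] k x; first by rewrite addn0 subnn.
have m_le : {homo m : i j / (i <= j)%N} by apply: homo_leq => //; exact: leq_trans.
have -> : (m (k + n.+1) - m k = (m k.+1 - m k) + (m (k.+1 + n) - m k.+1))%N.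
  have := mS k; have := m_le k.+1 (k.+1 + n)%N (leq_addr _ _).
  by rewrite addnS addSn; lia.
rewrite (@ilim_block _ _ F mF M FM _ _ (a k) (fun i => C k (m k + i)%N))//; last first.
  by move=> i ip; apply: BC; rewrite leq_addr/= -ltn_subRL.
have -> : \sum_(i < m k.+1 - m k) C k (m k + i)%N = 1.
  rewrite -(C1 k) -[in RHS](add0n (m k)) big_addn big_mkord.
  by apply: eq_bigr => i _; rewrite addnC.
rewrite mulr1 ilimS_scons /= addn0; congr (lim (_ @ F)); apply/funext => v.
transitivity (ilim F (m (k.+1 + n) - m k.+1) (fun i => B (m k.+1 + i)%N) (x + a k *: v)).
  by congr ilim; apply/funext => i; rewrite addnA subnKC.
by rewrite IH; congr ilim; apply/funext => i; rewrite addnS.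
Qed.

Variables (E : normedModType R) (e : nat -> E).
Hypothesis eE : forall n (a : nat -> R),
  `|\sum_(i < n) a i *: e i| = ilim F n a 0.

Lemma convex_block_norm (w : nat -> E) n (a : 'I_n -> R) :
  convex_block_sequence e w ->
  `|\sum_(i < n) a i *: w i| = `|\sum_(i < n) a i *: e i|.
Proof.
move=> [Fk [c [Flt c0 c1 wE]]].
(* Consecutive half-open intervals starting at [0], the [k]-th containing [Fk k]; indices in the
   gaps receive weight zero in [C]. *)
pose m k := if k is j.+1 then (\max_(i <- Fk j) i.+1)%N else 0%N.
have Fm k i : i \in Fk k -> (m k <= i < m k.+1)%N.
  move=> ik; rewrite /= leq_bigmax_seq// andbT.
  case: k ik => //= k ik; apply/bigmax_leqP_seq => j jk _.
  exact: (Flt k k.+1).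
have mS k : (m k <= m k.+1)%N.
  have [i ik] : exists i, i \in Fk k.
    apply: contrapT => /forallNP ne; have := c1 k.
    rewrite big_seq big_pred0 => [/esym/eqP|i]; first by rewrite oner_eq0.
    by apply/negP; exact: ne.
  by have /andP[? ?] := Fm _ _ ik; lia.
have m_le : {homo m : i j / (i <= j)%N} by apply: homo_leq => //; exact: leq_trans.
pose C k i := if i \in Fk k then c i else 0.
pose b := extend_ord 0 a.
(* These are the coefficients of the combination of the [w k] with respect to [e]. *)
pose B i := \sum_(k < n) b k * C k i.
have BC k i : (m k <= i < m k.+1)%N -> B i = b k * C k i.
  move=> /andP[ki ik].
  have Cz j : j != k -> C j i = 0.
    move=> jk; rewrite /C; case: ifP => // /Fm/andP[ji ij].
    by have [/m_le|/m_le|jk'] := ltngtP j k; [lia|lia|rewrite jk' eqxx in jk].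
  have [kn|nk] := ltnP k n.
    rewrite /B (bigD1 (Ordinal kn))//= big1 ?addr0// => j jk.
    by rewrite Cz ?mulr0.
  rewrite /B big1 => [|j _]; last first.
    by rewrite Cz ?mulr0// neq_ltn (leq_trans _ nk).
  by rewrite /b /extend_ord insubF/= ?mul0r// ltnNge nk.
have -> : \sum_(i < n) a i *: w i = \sum_(i < m n) B i *: e i.
  under [RHS]eq_bigr do rewrite /B scaler_suml.
  rewrite exchange_big; apply: eq_bigr => k _ /=.
  rewrite /b extend_ordE wE scaler_sumr.
  rewrite -(@big_seq_interval _ (Fk k) 0 (m n)) ?fset_uniq//; last first.
    by move=> i /Fm/andP[_ ik]; exact: leq_trans ik (m_le _ _ (ltn_ord k)).
  rewrite big_mkord; apply: eq_bigr => i _; rewrite /C.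
  by case: ifP; rewrite ?mulr0 ?scale0r// scalerA.
rewrite eE.
have -> : \sum_(i < n) a i *: e i = \sum_(i < n) b i *: e i.
  by apply: eq_bigr => i _; rewrite /b extend_ordE.
rewrite eE -(@ilim_blocks m C B b n 0)//; first by rewrite subn0.
- by move=> k i; rewrite /C; case: ifP.
- move=> k; rewrite -(c1 k) /C big_seq_interval ?fset_uniq//; exact: Fm.
Qed.

End homogeneity.

Section iterated_limit_space.
Context {R : realType} {X : normedModType R} (F : set_system X).
Hypothesis mF : maximal_convex_filter F.
Variable M : R.
Hypothesis FM : \forall v \near F, `|v| <= M.

(* Polynomials serve as the finitely supported sequences, ['X^i] as the unit
   vectors. *)
Definition poly_ilim (q : {poly R}) : R := ilim F (size q) (fun i => q`_i) 0.

Lemma poly_ilimE (q : {poly R}) n : (size q <= n)%N ->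
  poly_ilim q = ilim F n (fun i => q`_i) 0.
Proof.
move=> qn; rewrite -(subnKC qn) (ilim_pad mF)//.
by move=> i qi; rewrite nth_default.
Qed.

Lemma poly_ilim_triangle (u v : {poly R}) :
  poly_ilim (u + v) <= poly_ilim u + poly_ilim v.
Proof.
rewrite (poly_ilimE (size_polyD u v)) (poly_ilimE (leq_maxl _ (size v))).
rewrite (poly_ilimE (leq_maxr (size u) _)).
have := ilimD mF FM (maxn (size u) (size v)) (fun i => u`_i) (fun i => v`_i) 0 0.
by rewrite addr0; under eq_fun do rewrite -coefD.
Qed.

Lemma poly_ilim_scale a (u : {poly R}) : poly_ilim (a *: u) = `|a| * poly_ilim u.
Proof.
rewrite (poly_ilimE (size_scale_leq a u)) -(ilimZ mF FM) scaler0.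
by congr ilim; apply/funext => i; rewrite coefZ.
Qed.

Definition poly_ilim_seminorm : seminorm {poly R} :=
  Seminorm poly_ilim_triangle poly_ilim_scale.

Variables K d : R.
Hypothesis d0 : 0 < d.
Hypothesis ilim_sum : forall n (a : nat -> R) x,
  d * `|\sum_(i < n) a i| <= ilim F n a x.
Hypothesis ilim_basis_K : forall n k (a : nat -> R) x,
  ilim F n a x <= K * ilim F (n + k) a x.

Lemma ilim_space_exists : exists (E : completeNormedModType R) (e : nat -> E),
  (forall n (a : nat -> R), `|\sum_(i < n) a i *: e i| = ilim F n a 0) /\
  schauder_basic_sequence e.
Proof.
have definite u : poly_ilim_seminorm u = 0 -> u = 0.
  rewrite -[_ u]/(poly_ilim u) => u0.
  (* Once the lower coefficients vanish, the sum of the first [n.+1] is the [n]-th alone, and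
     [ilim_sum] with the basis constant forces it to be zero. *)
  apply/polyP => n; rewrite coef0; elim/ltn_ind: n => n IH.
  have := ilim_basis_K n.+1 (size u) (fun i => u`_i) 0.
  rewrite -(poly_ilimE (leq_addl n.+1 (size u))) u0 mulr0 => h.
  have := le_trans (ilim_sum n.+1 (fun i => u`_i) 0) h.
  rewrite big_ord_recr /= big1 => [|i _]; last by apply: IH; exact: ltn_ord.
  by rewrite add0r pmulr_rle0// normr_le0 => /eqP.
have [E [i iE]] := seminorm_completion definite.
have eE n (a : nat -> R) : `|\sum_(j < n) a j *: i 'X^j| = ilim F n a 0.
  have -> : \sum_(j < n) a j *: i 'X^j = i (\poly_(j < n) a j).
    by rewrite poly_def linear_sum; apply: eq_bigr => j _; rewrite linearZ.
  rewrite iE -[LHS]/(poly_ilim _) (poly_ilimE (size_poly _ _)).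
  by apply: ilim_ext => j jn; rewrite coef_poly jn.
exists E, (fun j => i 'X^j); split=> //.
have eK m n (a : nat -> R) : (m <= n)%N ->
    `|\sum_(j < m) a j *: i 'X^j| <= K * `|\sum_(j < n) a j *: i 'X^j|.
  by move=> mn; rewrite !eE -(subnKC mn).
apply: (schauder_basic_criterion d0) eK => j.
(* Applied to a unit vector, the sum bound gives the lower bound [d] on the norms of the basis
   vectors. *)
have := ilim_sum j.+1 (fun k => (k == j)%:R) 0.
have s1 (V : lmodType R) (f : nat -> V) : \sum_(k < j.+1) (k == j :> nat)%:R *: f k = f j.
  rewrite big_ord_recr /= eqxx scale1r big1 ?add0r// => k _.
  by rewrite ltn_eqF// scale0r.
rewrite -eE /= (s1 E (fun k => i 'X^k)).
have -> : \sum_(k < j.+1) (k == j :> nat)%:R = 1 :> R.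
  rewrite big_ord_recr /= eqxx big1 ?add0r// => k _.
  by rewrite ltn_eqF.
by rewrite normr1 mulr1.
Qed.

End iterated_limit_space.

(** * Assembly of the spreading model *)

Theorem proposition7 (R : realType) (X : completeNormedModType R) :
  ~ reflexive_space X ->
  exists (x : nat -> X) (E : completeNormedModType R) (e : nat -> E),
    generates_spreading_model x (norm_seminorm E) e /\
    convex_block_homogeneous1 e.
Proof.
move=> nX.
have [z zX] : exists z, ~ range (@canonical_embedding R X) z.
  apply: contrapT => /forallNP h; apply: nX; apply/seteqP; split=> // z _.
  by apply: contrapT; exact: h.
have [d [d0 dz]] := bidual_dist_gt0 zX.
have [F [mF FM Fz]] := bidual_convex_filter z.
have [E [e [eE e_basic]]] := ilim_space_exists mF FM d0
  (ilim_ge_sum mF FM Fz dz) (ilim_basis mF FM Fz d0 dz).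
have [x [xM x_spread]] := spreading_sequence_exists mF FM.
exists x, E, e; split; last first.
  by split=> // w ew n a; rewrite (convex_block_norm mF FM eE a ew).
split; first by exists `|z|.
move=> n eps /(x_spread n)[n0 h]; exists n0 => k kn0 kinc a a1.
have := h k kn0 kinc a a1; rewrite -eE.
by under [X in _ - `|X|]eq_bigr do rewrite extend_ordE.
Qed.
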